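(* Let $\alpha,\beta\in(0,1)$ with $\alpha+\beta<1$, and let $f$ be an $L^1$ function for which the Riemann--Liouville derivatives $D^{\alpha}f,D^{\beta}f,D^{\alpha+\beta}f$ are defined, where $D^{\nu}={}^{RL}D^{\nu}_{0+}$. If $f$ satisfies the semigroup property $$ {}^{AB}I^{\alpha}_{0+}\Big({}^{AB}I^{\beta}_{0+}f(t)\Big)={}^{AB}I^{\alpha+\beta}_{0+}f(t), $$ then $$ \bigg[\frac{(1-\alpha)(1-\beta)}{B(\alpha)B(\beta)}-\frac{1-\alpha-\beta}{B(\alpha+\beta)}\bigg]D^{\alpha+\beta}f+\frac{\alpha(1-\beta)}{B(\alpha)B(\beta)}D^{\beta}f+\frac{\beta(1-\alpha)}{B(\alpha)B(\beta)}D^{\alpha}f+\bigg[\frac{\alpha\beta}{B(\alpha)B(\beta)}-\frac{\alpha+\beta}{B(\alpha+\beta)}\bigg]f=0. $$ If moreover $B(\alpha)B(\beta)=B(\alpha+\beta)$, then this last equation is equivalent to $$ \alpha\beta D^{\alpha+\beta}f+\alpha(1-\beta)D^{\beta}f+\beta(1-\alpha)D^{\alpha}f+(\alpha\beta-\alpha-\beta)f=0. $$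
   Context: $B$ is a fixed normalisation function with real, strictly positive values and $B(0)=B(1)=1$. The Riemann--Liouville fractional integral of order $\nu>0$ is ${}^{RL}I^{\nu}_{0+}f(t)=\frac{1}{\Gamma(\nu)}\int_0^t(t-\tau)^{\nu-1}f(\tau)\,\mathrm{d}\tau$, and for $0<\nu<1$ the Riemann--Liouville derivative is ${}^{RL}D^{\nu}_{0+}f(t)=\frac{\mathrm{d}}{\mathrm{d}t}\,{}^{RL}I^{1-\nu}_{0+}f(t)$. For $\alpha\in(0,1)$ the AB fractional integral is ${}^{AB}I^{\alpha}_{0+}f(t)=\frac{1-\alpha}{B(\alpha)}f(t)+\frac{\alpha}{B(\alpha)}{}^{RL}I^{\alpha}_{0+}f(t)$. *)

(* Defs.v *)
From mathcomp Require Import all_boot all_order all_algebra.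
From mathcomp Require Import all_classical all_reals all_analysis.
Set Implicit Arguments.
Unset Strict Implicit.
Unset Printing Implicit Defensive.
Import Order.TTheory GRing.Theory Num.Theory.
Import numFieldNormedType.Exports.
Local Open Scope classical_set_scope.
Local Open Scope ring_scope.

Section AtanganaBaleanu.
Context {R : realType}.
Implicit Types (nu alpha t : R) (B f : R -> R) (T : \bar R).

Local Notation mu := (@lebesgue_measure R).

Definition normalisation B : Prop :=
  [/\ forall x, 0 <= x <= 1 -> 0 < B x, B 0 = 1 & B 1 = 1].

Definition Gamma nu : R :=
  \int[mu]_(x in `]0, +oo[) (x `^ (nu - 1) * expR (- x)).

(* All integrals are Lebesgue integrals.  For f in L^1 the integral below
   converges for almost every t only; at the remaining t the value of the
   library's (total) integral is a convention. *)
Definition RLint nu f t : R :=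
  (Gamma nu)^-1 * \int[mu]_(tau in `[0, t]) ((t - tau) `^ (nu - 1) * f tau).

Definition RLder nu f t : R := derive1 (RLint (1 - nu) f) t.

Definition ABint B alpha f t : R :=
  (1 - alpha) / B alpha * f t + alpha / B alpha * RLint alpha f t.

(* The domain ]0, T[ of the functions; T = +oo gives the half-line. *)
Definition dom T : set R := [set t | 0 < t /\ (t%:E < T)%E].

Definition L1 T f : Prop := mu.-integrable (dom T) (EFin \o f).

(* RLder is a total function, so that the existence of the derivative has to be
   required separately; as for any statement about L^1 functions, it is
   required almost everywhere. *)
Definition RLder_defined T nu f : Prop :=
  \forall t \ae mu, dom T t -> derivable (RLint (1 - nu) f) t 1.

Definition ae_eq_on T f g : Prop := f = g %[ae mu in dom T].

End AtanganaBaleanu.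

(* Main.v *)
Require Import Defs.
From mathcomp Require Import all_boot all_order all_algebra.
From mathcomp Require Import all_classical all_reals all_analysis.
From mathcomp Require Import measurable_realfun ring lra.
Import Order.TTheory GRing.Theory Num.Theory.
Import numFieldNormedType.Exports.
Local Open Scope classical_set_scope.
Local Open Scope ring_scope.

(** Applying the derivative of order alpha + beta to the semigroup equation
    gives the result, because it sends the function itself, its fractional
    integrals of orders alpha and beta, and its integral of order alpha + beta
    to D^(alpha+beta) f, D^beta f, D^alpha f and f.  The work is to justify
    this for a function that is merely integrable, on a half-line perhaps, with
    identities that hold almost everywhere only.

    Fractional integrals become convolutions of L^1 functions on the whole
    line: multiplication by exp(-t) turns the kernel t^(nu-1) / Gamma(nu) into
    the gamma density of order nu, which is a probability density, so that
    exp(-t) I^nu f(t) is the convolution of this density with the weighted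
    function exp(-s) f(s), extended by 0 outside the domain
    ([RLint_weighted]).  The composition rule I^a (I^b f) = I^(a+b) f a.e. is
    then the associativity of convolution, which is Fubini's theorem
    ([convolA]), together with the semigroup property of the gamma densities
    ([convol_gammad]).  For the latter, a scaling shows that the convolution of
    the densities of orders a and b is a constant multiple of the density of
    order a + b, and the constant is 1 since all the integrals are 1.

    With this, the semigroup equation says that a linear combination of the
    weighted function and its convolutions vanishes a.e. on the domain
    ([ae_ABint_comp]).  Convolving with the density of order
    1 - (alpha + beta) yields
    p I^(1-alpha-beta) f + q I^(1-alpha) f + r I^(1-beta) f + w I^1 f = 0
    a.e. on the domain ([ae_RLint_lincomb]).  The left-hand side is
    differentiable at almost every point, and a function that vanishes a.e. has
    derivative 0 wherever it is differentiable ([derive1_ae0]); the derivative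
    of I^1 f is f a.e. by Lebesgue's differentiation theorem
    ([RLint1_derive]). *)

(** * Affine changes of variable *)

Section affine.
Context {R : realType}.
Notation mu := (@lebesgue_measure R).
Local Open Scope ereal_scope.

Lemma measurable_affine (a b : R) :
  measurable_fun [set: R] (fun x : R => a * x + b)%R.
Proof.
by apply: measurable_funD => //; apply: measurable_funM => //.
Qed.

(** The Lebesgue measure is determined by its values on the intervals ]c, d]. *)
Lemma lebesgue_measure_affine (a b : R) (A : set R) : (0 < a)%R ->
  measurable A ->
  pushforward mu (fun x : R => (a * x + b)%R : measurableTypeR R) A =
  a^-1%:E * mu A.
Proof.
move=> a0 mA.
have a0' : (0 <= a)%R by exact: ltW.
pose f := (fun x : R => (a * x + b)%R : measurableTypeR R).
have mf : measurable_fun [set: measurableTypeR R] f.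
  exact: measurable_affine.
suff : mu A = mscale (NngNum a0') (pushforward mu f) A.
  by move=> ->; rewrite /mscale/= muleA -EFinM mulVf ?gt_eqF// mul1e.
move=> m; apply: lebesgue_measure_unique => //.
move=> _ [[c d]] /= cd <-.
rewrite /mscale/= /pushforward.
have -> : f @^-1` `]c, d] = `]((c - b) / a)%R, ((d - b) / a)%R]%classic.
  apply/seteqP; split => x /=; rewrite !in_itv/= /f;
  by rewrite ltr_pdivrMr// ler_pdivlMr// ltrBlDr lerBrDr mulrC.
rewrite !lebesgue_measure_itv/= !lte_fin ltr_pM2r ?invr_gt0// ltrD2r.
case: ifPn => _; last by rewrite mule0.
by rewrite -EFinB -EFinM; congr EFin; field; exact: lt0r_neq0.
Qed.

Lemma ge0_integral_affine (a b : R) (phi : R -> \bar R) : (0 < a)%R ->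
  measurable_fun [set: R] phi -> (forall x, 0 <= phi x) ->
  \int[mu]_x phi (a * x + b)%R = a^-1%:E * \int[mu]_x phi x.
Proof.
move=> a0 mphi phi0.
pose f := (fun x : R => (a * x + b)%R : measurableTypeR R).
have mf : measurable_fun [set: measurableTypeR R] f.
  exact: measurable_affine.
have ia0 : (0 <= a^-1)%R by rewrite invr_ge0 ltW.
transitivity (\int[mscale (NngNum ia0) mu]_x phi x); last first.
  by rewrite ge0_integral_mscale.
transitivity (\int[pushforward mu f]_x phi x).
  by rewrite ge0_integral_pushforward.
apply: eq_measure_integral => A mA _.
by rewrite /mscale/= lebesgue_measure_affine.
Qed.

(** Translating the positive and negative parts separately gives the equality also
    where the integral takes its conventional value. *)
Lemma integral_shift (b : R) (phi : R -> \bar R) :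
  measurable_fun [set: R] phi ->
  \int[mu]_x phi (x - b)%R = \int[mu]_x phi x.
Proof.
move=> mphi.
have sh (psi : R -> \bar R) : measurable_fun [set: R] psi ->
    (forall x, 0 <= psi x) -> \int[mu]_x psi (x - b)%R = \int[mu]_x psi x.
  move=> mpsi psi0.
  rewrite -[RHS]mul1e -[in RHS](invr1 R) -(ge0_integral_affine 1 (- b))//.
  by apply: eq_integral => x _; rewrite mul1r.
rewrite integralE [RHS]integralE -[X in _ = X - _]sh -1?[X in _ = _ - X]sh//;
  [|exact: measurable_funeneg|exact: measurable_funepos].
rewrite (funepos_comp phi (fun x => x - b)%R).
by rewrite (funeneg_comp phi (fun x => x - b)%R).
Qed.

End affine.

(** * Convolution of integrable functions *)

Section convolution.
Context {R : realType}.
Notation mu := (@lebesgue_measure R).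
Notation l1 k := (mu.-integrable setT (EFin \o k)).
Implicit Types (k l F G : R -> R) (t s c : R).

(** Absolute convergence of the integral that defines the convolution at t;
    outside such points the value of [convol] is a convention. *)
Definition convable k F t : Prop :=
  mu.-integrable setT (fun s => (k (t - s) * F s)%:E).

Definition convol k F t : R := \int[mu]_s (k (t - s) * F s).

Lemma measurable_conv_slice k F t :
  measurable_fun setT k -> measurable_fun setT F ->
  measurable_fun setT (fun s => (k (t - s) * F s)%:E).
Proof.
move=> mk mF; apply/measurable_EFinP/measurable_funM => //.
apply: (measurableT_comp mk).
by apply: measurable_funB.
Qed.

Lemma convableZ k F t c : convable k F t -> convable k (c \*o F) t.
Proof.
move=> kF; apply: eq_integrable (integrableZl measurableT c kF) => //.
by move=> s _ /=; rewrite -EFinM mulrCA.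
Qed.

Lemma convolZ k F t c : convable k F t ->
  convol k (c \*o F) t = c * convol k F t.
Proof.
move=> kF; rewrite /convol -RintegralZl//.
by apply: eq_Rintegral => s _; rewrite /= mulrCA.
Qed.

Lemma convableD k F G t : convable k F t -> convable k G t ->
  convable k (F \+ G) t.
Proof.
move=> kF kG; apply: eq_integrable (integrableD measurableT kF kG) => //.
by move=> s _ /=; rewrite -EFinD mulrDr.
Qed.

Lemma convolD k F G t : convable k F t -> convable k G t ->
  convol k (F \+ G) t = convol k F t + convol k G t.
Proof.
move=> kF kG; rewrite /convol -RintegralD//.
by apply: eq_Rintegral => s _; rewrite /= mulrDr.
Qed.

(** A kernel supported in the positive half-line sees only the values of F
    before t. *)
Lemma eq_convol_past k F G t : (forall x, x <= 0 -> k x = 0) ->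
  measurable_fun setT k -> measurable_fun setT F -> measurable_fun setT G ->
  {ae mu, forall s, s < t -> F s = G s} ->
  convol k F t = convol k G t.
Proof.
move=> k0 mk mF mG FG; congr fine.
apply: ae_eq_integral => //; do 2?[exact: measurable_conv_slice].
apply: (@filterS _ _ (ae_filter_ringOfSetsType mu)) FG => s FG _.
by have [/FG ->//|ts] := ltP s t; rewrite k0 ?mul0r// subr_le0.
Qed.

Notation R2 := (measurableTypeR R * measurableTypeR R)%type.

Lemma measurable_conv2 k F : measurable_fun setT k -> measurable_fun setT F ->
  measurable_fun [set: R2] (fun p => (k (p.1 - p.2) * F p.2)%:E).
Proof.
move=> mk mF; apply/measurable_EFinP/measurable_funM.
  apply: (measurableT_comp mk); apply: measurable_funB.
    exact: measurable_fst.
  exact: measurable_snd.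
by apply: (measurableT_comp mF); exact: measurable_snd.
Qed.

Lemma l1_measurable {k} : l1 k -> measurable_fun setT k.
Proof. by move=> /integrableP[/measurable_EFinP]. Qed.

(** The positive and negative parts of the integrand have measurable partial
    integrals by Tonelli's theorem, whether these are finite or not. *)
Lemma measurable_convol k F : measurable_fun setT k -> measurable_fun setT F ->
  measurable_fun setT (convol k F).
Proof.
move=> mk mF; have mkF := measurable_conv2 _ _ mk mF.
pose f (p : R2) := (k (p.1 - p.2) * F p.2)%:E.
rewrite (_ : convol k F = fine \o (fun t =>
    fubini_F mu f^\+ t - fubini_F mu f^\- t)%E).
  apply: measurableT_comp => //; apply: emeasurable_funB.
    by apply: measurable_fun_fubini_tonelli_F => //; exact: measurable_funepos.
  by apply: measurable_fun_fubini_tonelli_F => //; exact: measurable_funeneg.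
apply/funext => t; congr fine; rewrite integralE /fubini_F; congr (_ - _)%E.
  by rewrite (funepos_comp f (fun s => (t, s))).
by rewrite (funeneg_comp f (fun s => (t, s))).
Qed.

(** Translation invariance makes the iterated integral of the absolute value the
    product of the two L^1 norms. *)
Lemma integrable_conv2 k F : l1 k -> l1 F ->
  (mu \x mu)%E.-integrable [set: R2] (fun p => (k (p.1 - p.2) * F p.2)%:E).
Proof.
move=> ik iF; have mk := l1_measurable ik; have mF := l1_measurable iF.
apply/integrable21ltyP; first exact: measurable_conv2.
have mnk : measurable_fun setT (fun t => `|k t|%:E).
  by apply/measurable_EFinP; exact: measurableT_comp.
have mnF : measurable_fun setT (fun t => `|F t|%:E).
  by apply/measurable_EFinP; exact: measurableT_comp.
have inner s : (\int[mu]_t `|(k (t - s) * F s)%:E| =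
    (\int[mu]_t `|k t|%:E) * `|F s|%:E)%E.
  rewrite -(integral_shift s (fun t => `|k t|%:E))// -ge0_integralZr//.
    by apply: eq_integral => t _; rewrite /= normrM EFinM.
  apply/measurable_EFinP; apply: (measurableT_comp (@normr_measurable _ _)) => //.
  by apply: (measurableT_comp mk); apply: measurable_funB.
under eq_integral do rewrite inner.
rewrite ge0_integralZl//; last exact: integral_ge0.
move/integrableP: ik => [_ ik]; move/integrableP: iF => [_ iF].
by rewrite lte_mul_pinfty ?integral_ge0 ?ge0_fin_numE ?integral_ge0.
Qed.

Lemma ae_convable k F : l1 k -> l1 F -> {ae mu, forall t, convable k F t}.
Proof. by move=> ik iF; exact: (ae_integrable1 (integrable_conv2 _ _ ik iF)). Qed.

Lemma integrable_convol k F : l1 k -> l1 F -> l1 (convol k F).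
Proof.
move=> ik iF; have iI := integrable_fubini_F (integrable_conv2 _ _ ik iF).
apply: (le_integrable measurableT _ _ iI).
  apply/measurable_EFinP; apply: measurable_convol; exact: l1_measurable.
move=> t _; rewrite /= /convol /Rintegral /fubini_F.
by case: (\int[mu]_s (k (t - s) * F s)%:E)%E => //=; rewrite ?normr0 ?leey.
Qed.

Lemma l1_norm {k} : l1 k -> l1 (fun x => `|k x|).
Proof. exact: integrable_norm. Qed.

Lemma measurable_conv3 k l F t : measurable_fun setT k ->
  measurable_fun setT l -> measurable_fun setT F ->
  measurable_fun [set: R2]
    (fun p => (k (t - p.1) * (l (p.1 - p.2) * F p.2))%:E).
Proof.
move=> mk ml mF; apply/measurable_EFinP/measurable_funM; last first.
  by apply/measurable_EFinP; exact: measurable_conv2.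
by apply: (measurableT_comp mk); apply: measurable_funB => //; exact: measurable_fst.
Qed.

(** The iterated integral of the absolute value over (s, y) is the convolution of
    |k| with that of |l| and |F|, which converges for almost every t. *)
Lemma ae_integrable_conv3 k l F : l1 k -> l1 l -> l1 F ->
  {ae mu, forall t, (mu \x mu)%E.-integrable [set: R2]
    (fun p => (k (t - p.1) * (l (p.1 - p.2) * F p.2))%:E)}.
Proof.
move=> ik il iF.
have ilF := integrable_convol _ _ (l1_norm il) (l1_norm iF).
have := ae_convable _ _ (l1_norm ik) ilF.
apply: (@filterS _ _ (ae_filter_ringOfSetsType mu)) => t kt.
have [mk ml mF] := And3 (l1_measurable ik) (l1_measurable il) (l1_measurable iF).
apply/integrable12ltyP; first exact: measurable_conv3.
move/integrableP : kt => [mkt]; apply: le_lt_trans.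
apply: ae_ge0_le_integral => //.
- by move=> x _; exact: integral_ge0.
- apply: (measurable_fun_fubini_tonelli_F
    (abse \o (fun p : R2 => (k (t - p.1) * (l (p.1 - p.2) * F p.2))%:E))) => //.
  + by apply: measurableT_comp => //; exact: measurable_conv3.
  + by move=> p; exact: abse_ge0.
- exact: measurableT_comp.
have := ae_convable _ _ (l1_norm il) (l1_norm iF).
apply: (@filterS _ _ (ae_filter_ringOfSetsType mu)) => s ls _.
rewrite le_eqVlt; apply/orP; left; apply/eqP.
transitivity (`|k (t - s)|%:E * \int[mu]_y (`|l (s - y)| * `|F y|)%:E)%E.
  rewrite -integralZl//.
  by apply: eq_integral => y _; rewrite -EFinM /= !normrM.
rewrite -[X in (_ * X)%E]fineK; last exact: integrable_fin_num.
rewrite -EFinM /= normrM normr_id ger0_norm//.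
by apply: Rintegral_ge0 => y _; rewrite mulr_ge0.
Qed.

(** Fubini's theorem at every t where the triple integral converges absolutely.
    After the exchange, the integral over s is a translate of the one that
    defines the convolution of k and l. *)
Lemma convolA k l F : l1 k -> l1 l -> l1 F ->
  {ae mu, forall t, convol k (convol l F) t = convol (convol k l) F t}.
Proof.
move=> ik il iF.
have [mk ml mF] := And3 (l1_measurable ik) (l1_measurable il) (l1_measurable iF).
have := ae_integrable_conv3 _ _ _ ik il iF.
apply: (@filterS _ _ (ae_filter_ringOfSetsType mu)) => t iK.
congr fine.
transitivity (\int[mu]_s \int[mu]_y (k (t - s) * (l (s - y) * F y))%:E)%E.
  apply: ae_eq_integral => //.
  - by apply: measurable_conv_slice => //; exact: measurable_convol.
  - exact: measurable_int (integrable_fubini_F iK).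
  have := ae_convable _ _ il iF.
  apply: (@filterS _ _ (ae_filter_ringOfSetsType mu)) => s ls _.
  rewrite EFinM fineK; last exact: integrable_fin_num.
  by rewrite -integralZl//.
rewrite (Fubini iK); apply: ae_eq_integral => //.
- exact: measurable_fubini_G iK.
- by apply: measurable_conv_slice => //; exact: measurable_convol.
have := ae_integrable2 iK.
apply: (@filterS _ _ (ae_filter_ringOfSetsType mu)) => y iy _.
have [Fy0|Fy0] := eqVneq (F y) 0.
  by rewrite Fy0 mulr0 integral0_eq// => s _; rewrite mulr0 mulr0.
have ikl : mu.-integrable setT (fun s => (k (t - s) * l (s - y))%:E).
  apply: eq_integrable (integrableZr measurableT (F y)^-1 iy) => //.
  by move=> s _ /=; rewrite -EFinM mulrA mulfK.
transitivity ((\int[mu]_s (k (t - s) * l (s - y))%:E) * (F y)%:E)%E.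
  by rewrite -integralZr//; apply: eq_integral => s _; rewrite -EFinM mulrA.
rewrite EFinM; congr (_ * _)%E.
rewrite -[LHS]fineK; last exact: integrable_fin_num.
congr (fine _)%:E.
rewrite -(integral_shift y (fun s => (k (t - y - s) * l s)%:E)); last first.
  exact: measurable_conv_slice.
by apply: eq_integral => s _; rewrite opprB addrA subrK.
Qed.

End convolution.

(** * The gamma densities and their convolution semigroup *)

Section gamma_density.
Context {R : realType}.
Notation mu := (@lebesgue_measure R).
Notation l1 k := (mu.-integrable setT (EFin \o k)).
Implicit Types (a b c t x : R).

(** The power of the Riemann-Liouville kernel, with the causal convention that it
    vanishes for x <= 0 whatever the exponent. *)
Definition powpos a x : R := if 0 < x then x `^ (a - 1) else 0.

Lemma powpos_ge0 a x : 0 <= powpos a x.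
Proof. by rewrite /powpos; case: ifPn => // _; exact: powR_ge0. Qed.

Lemma powpos_le0 a x : x <= 0 -> powpos a x = 0.
Proof. by rewrite /powpos ltNge => ->. Qed.

Lemma powposZ a c x : 0 < c -> powpos a (c * x) = c `^ (a - 1) * powpos a x.
Proof.
move=> c0; rewrite /powpos pmulr_rgt0//; case: ifPn => [x0|_]; last by rewrite mulr0.
by rewrite powRM// ltW.
Qed.

Lemma measurable_powpos a : measurable_fun setT (powpos a).
Proof.
apply: measurable_fun_if => //.
- exact: measurable_fun_ltr.
- exact: measurable_funTS.
Qed.

Lemma integral_powpos_itv a (e : R) : 0 < a -> 0 < e < 1 ->
  (\int[mu]_(x in `[e, 1%R]) (powpos a x)%:E = (a^-1 * (1 - e `^ a))%:E)%E.
Proof.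
move=> a0 /andP[e0 e1].
have der x : 0 < x -> is_derive x 1 (fun y => a^-1 * y `^ a) (x `^ (a - 1)).
  move=> x0; apply: is_derive_eq (is_deriveZ a^-1 (is_derive1_powR a x0)) _.
  by rewrite /GRing.scale/= mulrA mulVf ?gt_eqF// mul1r.
have cont x : 0 < x -> {for x, continuous (fun y => a^-1 * y `^ a)}.
  move=> x0; apply/differentiable_continuous/derivable1_diffP.
  by have [] := der x x0.
transitivity (\int[mu]_(x in `[e, 1%R]) (x `^ (a - 1))%:E)%E.
  apply: eq_integral => x; rewrite inE/= in_itv/= => /andP[ex _].
  by rewrite /powpos (lt_le_trans e0 ex).
rewrite (@continuous_FTC2 _ _ (fun y => a^-1 * y `^ a))//.
- by rewrite powR1 mulr1 -EFinB mulrBr mulr1.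
- apply: continuous_in_subspaceT => x; rewrite inE/= in_itv/= => /andP[ex _].
  apply/differentiable_continuous/derivable1_diffP/derivable_powR.
  by rewrite in_itv/= andbT (lt_le_trans e0 ex).
- split.
  + by move=> x; rewrite in_itv/= => /andP[ex _]; have [] := der x (lt_trans e0 ex).
  + by apply: cvg_at_right_filter; exact: cont.
  + by apply: cvg_at_left_filter; exact: cont.
- move=> x; rewrite in_itv/= => /andP[ex _].
  by rewrite derive1E; have [] := der x (lt_trans e0 ex).
Qed.

Lemma itv_bigcup_invn :
  \bigcup_i `[(i.+2%:R^-1 : R), 1]%classic = `]0, 1]%classic.
Proof.
apply/seteqP; split => [x [i _]|x]; rewrite /= !in_itv/= => /andP[x0 x1].
  by rewrite x1 (lt_le_trans _ x0).
exists (Num.truncn x^-1) => //=; rewrite in_itv/= x1 andbT.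
rewrite invf_ple ?posrE//.
by rewrite (le_trans (ltW (truncnS_gt _)))// ler_nat.
Qed.

(** The antiderivative x^a / a is bounded near 0, and ]0, 1] is the union of the
    intervals [1/(i+2), 1]. *)
Lemma integral_powpos01_lty a : 0 < a ->
  (\int[mu]_(x in `]0%R, 1%R]) (powpos a x)%:E < +oo)%E.
Proof.
move=> a0; rewrite -itv_bigcup_invn.
have mp : measurable_fun setT (fun x => (powpos a x)%:E).
  by apply/measurable_EFinP; exact: measurable_powpos.
apply: (@le_lt_trans _ _ a^-1%:E); last exact: ltry.
have cv : (\int[mu]_(x in `[(i.+2%:R^-1 : R)%R, 1%R]) (powpos a x)%:E @[i --> \oo]
    --> \int[mu]_(x in \bigcup_i `[(i.+2%:R^-1 : R)%R, 1%R]%classic) (powpos a x)%:E)%E.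
  apply: ge0_nondecreasing_set_cvg_integral => //.
  - move=> i j ij; apply/subsetPset => x /=; rewrite !in_itv/= => /andP[ix ->].
    by rewrite andbT (le_trans _ ix)// lef_pV2 ?posrE// ler_nat !ltnS.
  - by move=> i; exact: measurable_funTS.
  - by move=> i x _; rewrite lee_fin powpos_ge0.
apply: (cvge_to_le cv).
near=> i; rewrite integral_powpos_itv//; last first.
  by rewrite invr_gt0 ltr0n/= invf_lt1// ltr1n.
by rewrite lee_fin ler_piMr ?invr_ge0 ?(ltW a0)// gerBl powR_ge0.
Unshelve. all: end_near. Qed.

(** Domination by x^(a-1) on ]0, 1] and by exp(-x) beyond 1, where
    x^(a-1) <= 1 because a <= 1. *)
Lemma integrable_gamma a : 0 < a <= 1 ->
  l1 (fun x => powpos a x * expR (- x)).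
Proof.
move=> /andP[a0 a1].
have i01 : l1 (powpos a \_ `]0, 1]).
  rewrite -restrict_EFin; apply: (integrable_mkcond _ _).1 => //.
  apply/integrableP; split.
    by apply: measurable_funTS; apply/measurable_EFinP; exact: measurable_powpos.
  under eq_integral do rewrite /= ger0_norm ?powpos_ge0//.
  exact: integral_powpos01_lty.
have := integrableD measurableT i01 (integrable_exponential_pdf ltr01).
apply: le_integrable => //.
  apply/measurable_EFinP; apply: measurable_funM; first exact: measurable_powpos.
  exact: (measurableT_comp (@measurable_expR R)).
move=> x _ /=; rewrite lee_fin ger0_norm ?mulr_ge0 ?powpos_ge0 ?expR_ge0//.
apply: le_trans (ler_norm _); rewrite patchE.
have [x0|x0] := leP x 0.
  rewrite powpos_le0// mul0r addr_ge0 ?exponential_pdf_ge0//.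
  by case: ifPn => // _; rewrite powpos_ge0.
rewrite exponential_pdfE ?(ltW x0)//= mul1r mulN1r.
have [x1|x1] := leP x 1.
  rewrite mem_set/= ?in_itv/= ?x0//.
  rewrite ler_wpDr ?expR_ge0// ler_piMr ?powpos_ge0//.
  by rewrite expR_le1 oppr_le0 ltW.
rewrite ler_wpDl//.
  by case: ifPn => // _; rewrite powpos_ge0.
rewrite ler_piMl ?expR_ge0// /powpos x0 -[leRHS](powRr0 x).
by rewrite ler_powR ?(ltW x1)// subr_le0.
Qed.

Lemma Gamma_powpos a : Gamma a = \int[mu]_x (powpos a x * expR (- x)).
Proof.
rewrite /Gamma Rintegral_mkcond; apply: eq_Rintegral => x _.
rewrite patchE /powpos (_ : x \in _ = (0 < x)); last first.
  by apply/idP/idP; rewrite inE/= in_itv/= andbT.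
by case: ifPn; rewrite ?mul0r.
Qed.

(** On ]0, 1] the integrand is at least exp(-1). *)
Lemma Gamma_gt0 a : 0 < a <= 1 -> 0 < Gamma a.
Proof.
move=> a01; have ig := integrable_gamma a a01; case/andP: a01 => a0 a1.
apply: (@lt_le_trans _ _ (expR (- 1))); first exact: expR_gt0.
rewrite Gamma_powpos -lee_fin fineK; last exact: integrable_fin_num.
have g0 x : (0 <= (powpos a x * expR (- x))%:E)%E.
  by rewrite lee_fin mulr_ge0 ?powpos_ge0 ?expR_ge0.
apply: (@le_trans _ _
    (\int[mu]_(x in `]0%R, 1%R]) (powpos a x * expR (- x))%:E)%E); last first.
  by apply: ge0_subset_integral => //; exact: measurable_int ig.
have -> : (expR (- 1))%:E = (\int[mu]_(x in `]0%R, 1%R]) (expR (- 1) : R)%:E)%E.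
  rewrite integral_cst//= lebesgue_measure_itv/= lte_fin ltr01.
  by rewrite -EFinB subr0 mule1.
apply: ge0_le_integral => //.
- by apply: measurable_funTS; exact: measurable_int ig.
move=> x /=; rewrite in_itv/= => /andP[x0 x1].
rewrite lee_fin /powpos x0 -[leLHS]mul1r ler_pM ?expR_ge0//.
  by rewrite -[leLHS](powRr0 x) ger_powR ?x0// subr_le0.
by rewrite ler_expR lerN2.
Qed.

(** The density of the gamma distribution of shape a and scale 1. *)
Definition gammad a x : R := (Gamma a)^-1 * (powpos a x * expR (- x)).

Lemma gammad_ge0 a x : 0 < a <= 1 -> 0 <= gammad a x.
Proof.
move=> a01; rewrite /gammad mulr_ge0 ?invr_ge0 ?(ltW (Gamma_gt0 _ _))//.
by rewrite mulr_ge0 ?powpos_ge0 ?expR_ge0.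
Qed.

Lemma gammad_le0 a x : x <= 0 -> gammad a x = 0.
Proof. by move=> x0; rewrite /gammad powpos_le0// mul0r mulr0. Qed.

Lemma integrable_gammad a : 0 < a <= 1 -> l1 (gammad a).
Proof.
move=> /integrable_gamma/(integrableZl measurableT (Gamma a)^-1).
by apply: eq_integrable.
Qed.

Lemma measurable_gammad a : measurable_fun setT (gammad a).
Proof.
apply: measurable_funM => //; apply: measurable_funM.
  exact: measurable_powpos.
exact: (measurableT_comp (@measurable_expR R)).
Qed.

Lemma integral_gammad a : 0 < a <= 1 -> (\int[mu]_x (gammad a x)%:E = 1)%E.
Proof.
move=> a01; under eq_integral do rewrite EFinM.
rewrite integralZl//; last exact: integrable_gamma.
rewrite -[X in (_ * X)%E]fineK; last exact/integrable_fin_num/integrable_gamma.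
rewrite -[fine _]Gamma_powpos -EFinM mulVf// gt_eqF//.
exact: Gamma_gt0.
Qed.

(** For t > 0 the substitution s = t u takes every power of t and the factor
    exp(-t) out of the integral.  The constant is an extended real, as the
    convergence of the remaining Beta integral is only a consequence of
    [convol_gammad]. *)
Lemma integral_gammad_conv_prop a b : 0 < a <= 1 -> 0 < b <= 1 -> a + b <= 1 ->
  exists2 C : \bar R, (0 <= C)%E & forall t,
  (\int[mu]_s (gammad a (t - s) * gammad b s)%:E =
    C * (gammad (a + b) t)%:E)%E.
Proof.
move=> a01 b01 ab1.
have [a0 b0] : 0 < a /\ 0 < b by case/andP: a01; case/andP: b01.
have ab01 : 0 < a + b <= 1 by rewrite addr_gt0.
have Ga := Gamma_gt0 _ a01; have Gb := Gamma_gt0 _ b01.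
have Gab := Gamma_gt0 _ ab01.
pose I := (\int[mu]_u (powpos a (1 - u) * powpos b u)%:E)%E.
exists ((Gamma (a + b) / (Gamma a * Gamma b))%:E * I)%E.
  have I0 : (0 <= I)%E.
    by apply: integral_ge0 => u _; rewrite lee_fin mulr_ge0 ?powpos_ge0.
  apply: mule_ge0 I0; rewrite lee_fin.
  exact: divr_ge0 (ltW Gab) (mulr_ge0 (ltW Ga) (ltW Gb)).
move=> t; have [t0|t0] := leP t 0.
  rewrite gammad_le0// mule0 integral0_eq// => s _.
  have [s0|s0] := leP s 0; first by rewrite (gammad_le0 b)// mulr0.
  by rewrite (gammad_le0 a) ?mul0r// subr_le0 (le_trans t0)// ltW.
pose phi s := (gammad a (t - s) * gammad b s)%:E.
have mphi : measurable_fun setT phi.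
  by apply: measurable_conv_slice; exact: measurable_gammad.
have phi0 s : (0 <= phi s)%E by rewrite lee_fin mulr_ge0 ?gammad_ge0.
have -> : (\int[mu]_s phi s = t%:E * \int[mu]_u phi (t * u + 0)%R)%E.
  by rewrite ge0_integral_affine// muleA -EFinM mulfV ?gt_eqF// mul1e.
pose c := (Gamma a)^-1 * (Gamma b)^-1 * (t `^ (a - 1) * t `^ (b - 1) * expR (- t)).
have regroup (ga gb ta tb pa pb ea eb : R) :
    ga * (ta * pa * ea) * (gb * (tb * pb * eb)) =
    ga * gb * (ta * tb * (ea * eb)) * (pa * pb) by ring.
have phiE u : phi (t * u + 0)%R = (c%:E * (powpos a (1 - u) * powpos b u)%:E)%E.
  rewrite /phi addr0 -EFinM; congr EFin.
  rewrite /gammad (_ : t - t * u = t * (1 - u)); last by rewrite mulrBr mulr1.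
  rewrite !powposZ// /c.
  have -> : expR (- t) = expR (- (t * (1 - u))) * expR (- (t * u)).
    by rewrite -expRD; congr expR; ring.
  exact: regroup.
under eq_integral do rewrite phiE.
rewrite ge0_integralZl//; last 3 first.
- by apply: measurable_conv_slice; exact: measurable_powpos.
- by move=> u _; rewrite lee_fin mulr_ge0 ?powpos_ge0.
- rewrite lee_fin /c.
  apply: mulr_ge0 (mulr_ge0 (mulr_ge0 (powR_ge0 _ _) (powR_ge0 _ _)) (expR_ge0 _)).
  by apply: mulr_ge0; rewrite invr_ge0; [exact: ltW Ga|exact: ltW Gb].
rewrite -/I [RHS]muleAC muleA -!EFinM; congr (_%:E * _)%E.
rewrite /c /gammad /powpos t0.
have -> : t `^ (a + b - 1) = t * (t `^ (a - 1) * t `^ (b - 1)).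
  rewrite -[X in X * _](powRr1 (ltW t0)) -!powRD ?(gt_eqF t0) ?implybT//.
  by congr powR; ring.
(* Abstracted, the integrals that define Gamma are not unfolded by field. *)
move: (Gamma a) (Gamma b) (Gamma (a + b)) Ga Gb Gab => ga gb gab Ga Gb Gab.
move: (t `^ (a - 1)) (t `^ (b - 1)) (expR (- t)) => ta tb et.
by field; rewrite !gt_eqF.
Qed.

Notation R2 := (measurableTypeR R * measurableTypeR R)%type.

(** The constant of proportionality is found by integrating over t, where
    Tonelli's theorem gives 1 on the left. *)
Lemma convol_gammad a b : 0 < a <= 1 -> 0 < b <= 1 -> a + b <= 1 ->
  convol (gammad a) (gammad b) = gammad (a + b).
Proof.
move=> a01 b01 ab1.
have ab01 : 0 < a + b <= 1.
  by case/andP: a01 => a0 _; case/andP: b01 => b0 _; rewrite addr_gt0.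
have [C C0 CE] := integral_gammad_conv_prop a b a01 b01 ab1.
suff C1 : C = 1%E.
  by apply/funext => t; rewrite /convol /Rintegral CE C1 mul1e.
have : (\int[mu]_t \int[mu]_s (gammad a (t - s) * gammad b s)%:E = 1)%E.
  rewrite (fubini_tonelli
    (fun p : R2 => (gammad a (p.1 - p.2) * gammad b p.2)%:E))/=.
  - rewrite -(integral_gammad b b01); apply: eq_integral => s _.
    under eq_integral do rewrite EFinM.
    rewrite ge0_integralZr//.
    + rewrite (integral_shift s (fun x => (gammad a x)%:E)).
        by rewrite integral_gammad// mul1e.
      by apply/measurable_EFinP; exact: measurable_gammad.
    + apply/measurable_EFinP; apply: (measurableT_comp (measurable_gammad a)).
      exact: measurable_funB.
    + by move=> t _; rewrite lee_fin gammad_ge0.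
    + by rewrite lee_fin gammad_ge0.
  - by apply: measurable_conv2; exact: measurable_gammad.
  - by move=> p; rewrite lee_fin mulr_ge0 ?gammad_ge0.
under eq_integral do rewrite CE.
rewrite ge0_integralZl//.
- by rewrite integral_gammad// mule1.
- by apply/measurable_EFinP; exact: measurable_gammad.
- by move=> t _; rewrite lee_fin gammad_ge0.
Qed.

End gamma_density.

(** * Fractional integrals as convolutions *)

Section Rintegral_scale.
Context d (X : measurableType d) (R : realType).
Variable m : {measure set X -> \bar R}.

(** The integral of a measurable function that is not integrable is infinite, and
    its real value is 0 by convention. *)
Lemma Rintegral_nonintegrable (D : set X) (f : X -> R) : measurable D ->
  measurable_fun D f -> ~ m.-integrable D (EFin \o f) ->
  \int[m]_(s in D) f s = 0.
Proof.
move=> mD mf nif; have : (\int[m]_(s in D) (f s)%:E)%E \isn't a fin_num.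
  apply/negP; rewrite -(integral_fin_num_abs m mD mf) => fi; apply: nif.
  by apply/integrableP; split=> //; apply/measurable_EFinP.
by rewrite /Rintegral; case: (\int[m]_(s in D) (f s)%:E)%E.
Qed.

(** Without integrability both sides are 0; this lets constants move in and out
    of fractional integrals at every t, including those where they diverge. *)
Lemma measurable_RintegralZl (D : set X) (c : R) (f : X -> R) :
  measurable D -> measurable_fun D f ->
  \int[m]_(s in D) (c * f s) = c * \int[m]_(s in D) f s.
Proof.
move=> mD mf; have [fint|nif] := pselect (m.-integrable D (EFin \o f)).
  by rewrite RintegralZl.
rewrite (Rintegral_nonintegrable D f)// mulr0.
have [->|c0] := eqVneq c 0.
  by under eq_Rintegral do rewrite mul0r; rewrite Rintegral_cst// mul0r.
apply: Rintegral_nonintegrable => //; first exact: measurable_funM.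
move=> icf; apply: nif; apply: eq_integrable (integrableZl mD c^-1 icf) => //.
by move=> s _ /=; rewrite -EFinM mulKf.
Qed.

End Rintegral_scale.

Section weighted_integral.
Context {R : realType}.
Notation mu := (@lebesgue_measure R).
Notation l1 k := (mu.-integrable setT (EFin \o k)).
Implicit Types (nu t s c : R) (f h F H : R -> R) (T : \bar R).

(** The exponential factors recombine since exp(-(t-s)) exp(-s) = exp(-t).  The
    statement holds at every t, and H is only related to h on ]0, t[, so that it
    applies to functions h that are themselves defined on part of the line. *)
Lemma RLint_convol nu h H t : measurable_fun setT H ->
  (forall s, s <= 0 -> H s = 0) ->
  (forall s, 0 < s < t -> H s = expR (- s) * h s) ->
  expR (- t) * RLint nu h t = convol (gammad nu) H t.
Proof.
move=> mH H0 Hh.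
have mg : measurable_fun setT (fun s => gammad nu (t - s) * H s).
  by apply/measurable_EFinP; apply: measurable_conv_slice => //; exact: measurable_gammad.
pose phi s := (t - s) `^ (nu - 1) * (expR s * H s).
have mphi : measurable_fun setT phi.
  apply: measurable_funM.
    apply: (measurableT_comp (measurable_powR _)).
    exact: measurable_funB.
  by apply: measurable_funM => //; exact: measurable_expR.
have intE : \int[mu]_(s in `[0, t]) ((t - s) `^ (nu - 1) * h s) =
    \int[mu]_(s in `]0, t[) phi s.
  rewrite /Rintegral integral_itv_bndoo.
    apply: eq_Rintegral => s; rewrite inE/= in_itv/= => st.
    by rewrite /phi Hh// expRN mulVKf// gt_eqF// expR_gt0.
  apply/measurable_EFinP; apply: eq_measurable_fun (measurable_funTS mphi) => s.
  rewrite inE/= in_itv/= => st.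
  by rewrite /phi Hh// expRN mulVKf// gt_eqF// expR_gt0.
rewrite /RLint intE mulrA -measurable_RintegralZl//; last exact: measurable_funTS.
rewrite Rintegral_mkcond; apply: eq_Rintegral => s _; rewrite patchE.
rewrite (_ : s \in _ = (0 < s < t)); last by apply/idP/idP; rewrite inE/= in_itv/=.
case: ifPn => [/andP[s0 st]|]; last first.
  rewrite negb_and -!leNgt => /orP[s0|ts]; first by rewrite H0// mulr0.
  by rewrite gammad_le0 ?mul0r// subr_le0.
rewrite /gammad /powpos subr_gt0 st /phi.
have -> : expR (- (t - s)) = expR (- t) * expR s by rewrite -expRD; congr expR; ring.
by ring.
Qed.

End weighted_integral.

(** * Derivatives of functions that vanish almost everywhere *)

Section vanishing.
Context {R : realType}.
Notation mu := (@lebesgue_measure R).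
Notation l1 k := (mu.-integrable setT (EFin \o k)).
Implicit Types (nu t s c : R) (f h F G : R -> R) (T : \bar R).

(** A right neighbourhood of t has positive measure. *)
Lemma ae_right_ex (P Q : set R) t : (\forall s \ae mu, P s) ->
  (\forall s \near t^'+, Q s) -> exists2 s, P s & Q s.
Proof.
move=> [N [mN N0 PN]] [e /= e0 eQ].
apply: contrapT => /forall2NP noPQ.
(* Otherwise P fails on a whole interval to the right of t. *)
have : (mu `]t, (t + e)%R[ <= mu N)%E.
  apply: le_measure; rewrite ?inE//= => s; rewrite /= in_itv/= => /andP[ts ste].
  apply: PN => Ps; have [//|] := noPQ s; apply; apply: eQ => //.
  by rewrite /ball/= ltr_distlC ste andbT (lt_trans _ ts)// gtrBl.
by rewrite N0 lebesgue_measure_itv/= lte_fin ltrDl e0 -EFinB addrAC subrr add0r lee_fin leNgt e0.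
Qed.

Lemma near_at_right (Q : set R) t :
  (\forall s \near t, Q s) -> \forall s \near t^'+, Q s.
Proof. exact: cvg_within. Qed.

(** Zeros of G accumulate at t from the right.  Hence G t = 0 by continuity, and
    the difference quotients vanish along a sequence that tends to t. *)
Lemma derive1_ae0 G t (D : set R) : D t -> open D ->
  (\forall s \ae mu, D s -> G s = 0) -> derivable G t 1 -> derive1 G t = 0.
Proof.
move=> Dt oD G0 dG.
have Dr : \forall s \near t^'+, D s.
  by apply: near_at_right; exact: open_nbhs_nbhs.
have zero Q : (\forall s \near t^'+, Q s) -> exists2 s, G s = 0 & Q s.
  move=> tQ; have [|s DG [Ds Qs]] := ae_right_ex _ (D `&` Q) t G0.
    by near=> s; split; near: s.
  by exists s => //; exact: DG.
have Gt0 : G t = 0.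
  apply: contrapT => /eqP Gt0.
  have cG : {for t, continuous G} by exact/differentiable_continuous/derivable1_diffP.
  have [|s -> /eqP] := zero (fun s => G s != 0); last by [].
  by apply: near_at_right; exact: (cvgr_neq0 _ cG).
apply: contrapT => /eqP dt0.
have dGE : h^-1 *: ((G \o shift t) (h *: 1) - G t) @[h --> 0^'] --> derive1 G t.
  by rewrite derive1E; exact: dG.
have [e /= e0 eG] := cvgr_neq0 _ dGE dt0.
have [|s Gs /eqP] := zero (fun s => G s != 0); last by [].
exists e => //= s; rewrite /ball_/= => ste ts.
apply/negP => /eqP Gs; have := eG (s - t); rewrite /ball_/= sub0r normrN distrC.
by rewrite /= [_ *: 1]mulr1 subrK Gs Gt0 subrr scaler0 eqxx subr_eq0 gt_eqF// => /(_ ste isT).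
Unshelve. all: end_near. Qed.

End vanishing.

(** * The domain, the integral of order 1 and the weighted function *)

Section domain.
Context {R : realType}.
Notation mu := (@lebesgue_measure R).
Notation l1 k := (mu.-integrable setT (EFin \o k)).
Implicit Types (nu t s c : R) (f h F G : R -> R) (T : \bar R).

Lemma open_dom T : open (dom T).
Proof.
case: T => [r| |].
- rewrite (_ : dom _ = `]0, r[%classic); first exact: interval_open.
  by apply/seteqP; split=> s; rewrite /dom /= in_itv/= lte_fin; [case=> -> ->|move/andP].
- rewrite (_ : dom _ = `]0, +oo[%classic); first exact: interval_open.
  by apply/seteqP; split=> s; rewrite /dom /= in_itv/= ?ltry ?andbT; [case|move=> ->].
- rewrite (_ : dom _ = set0); first exact: open0.
  by apply/seteqP; split=> s; rewrite /dom /= // => -[].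
Qed.

Lemma measurable_dom T : measurable (dom T).
Proof. by apply: open_measurable; exact: open_dom. Qed.

Lemma dom_lt T s t : dom T t -> 0 < s <= t -> dom T s.
Proof.
by move=> [t0 tT] /andP[s0 st]; split => //; rewrite (le_lt_trans _ tT)// lee_fin.
Qed.

(** The integrand is the exponential density of rate 1 except at 0. *)
Lemma Gamma1 : Gamma 1 = 1 :> R.
Proof.
rewrite Gamma_powpos; transitivity (\int[mu]_x exponential_pdf 1 x); last first.
  by rewrite /Rintegral integral_exponential_pdf.
congr fine; apply: ae_eq_integral => //.
- by apply: measurable_int (integrable_gamma 1 _); rewrite ltr01/=.
- by apply/measurable_EFinP; exact: measurable_exponential_pdf.
exists [set 0]; split => //; first exact: lebesgue_measure_set1.
move=> x /= /not_implyP[_]; apply: contra_notP => /eqP; rewrite neq_lt => /orP[x0|x0].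
  by rewrite powpos_le0 ?(ltW x0)// mul0r lt0_exponential_pdf.
by rewrite exponential_pdfE ?(ltW x0)//= mul1r mulN1r /powpos x0 subrr powRr0 mul1r.
Qed.

Lemma integrable_restrict_dom T f : L1 T f -> l1 (f \_ (dom T)).
Proof.
move=> L1f; rewrite -restrict_EFin.
by apply: (integrable_mkcond _ _).1 => //; exact: measurable_dom.
Qed.

Lemma RLint1E T f t : L1 T f -> dom T t ->
  RLint 1 f t = \int[mu]_(s in `]-oo, t]) (f \_ (dom T)) s.
Proof.
move=> L1f Tt; rewrite /RLint Gamma1 invr1 mul1r.
have mf : measurable_fun `]0, t[ (EFin \o f).
  apply: measurable_funS (measurable_int _ L1f); first exact: measurable_dom.
  move=> s; rewrite /= in_itv/= => /andP[s0 st].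
  by apply: (dom_lt T s t Tt); rewrite s0 ltW.
transitivity (\int[mu]_(s in `]0, t]) f s).
  transitivity (\int[mu]_(s in `[0, t]) f s).
    by apply: eq_Rintegral => s _; rewrite subrr powRr0 mul1r.
  by rewrite /Rintegral (integral_itv_bndoo true false)// (integral_itv_bndoo false false).
rewrite Rintegral_mkcond [RHS]Rintegral_mkcond; apply: eq_Rintegral => s _.
rewrite !patchE.
rewrite (_ : (s \in `]0, t]%classic) = (0 < s <= t)); last by apply/idP/idP; rewrite inE/= in_itv/=.
rewrite (_ : (s \in `]-oo, t]%classic) = (s <= t)); last by apply/idP/idP; rewrite inE/= in_itv/=.
have [st|_] := leP s t; last by rewrite andbF.
rewrite andbT; case: ifPn => s0.
  by rewrite mem_set//; apply: (dom_lt T s t Tt); rewrite s0.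
by rewrite memNset// => -[s0' _]; rewrite s0' in s0.
Qed.

(** Near t the integral of order 1 is an indefinite integral of the extension of
    f by 0, to which Lebesgue's differentiation theorem applies. *)
Lemma RLint1_derive T f : L1 T f ->
  \forall t \ae mu, dom T t ->
    derivable (RLint 1 f) t 1 /\ derive1 (RLint 1 f) t = f t.
Proof.
move=> L1f; have f0int := integrable_restrict_dom T f L1f.
have iy y : mu.-integrable `]-oo, y] (EFin \o (f \_ (dom T))).
  exact: integrableS f0int.
have := FTC1Ny iy (integrable_locally (measurable_dom T) L1f).
apply: (@filterS _ _ (ae_filter_ringOfSetsType mu)) => t [dF dFE] Tt.
have eqF : \forall s \near t,
    \int[mu]_(x in `]-oo, s]) (f \_ (dom T)) x = RLint 1 f s.
  have : \forall s \near t, dom T s by apply: open_nbhs_nbhs; split=> //; exact: open_dom.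
  by apply: filterS => s Ts; rewrite (RLint1E T f s L1f Ts).
split; first exact: near_eq_derivable eqF dF.
by rewrite derive1E -(@near_eq_derive _ _ _ _ _ t 1 eqF) -derive1E dFE patchE mem_set.
Qed.

(** For f in L^1 of the domain, the exponential weight keeps the convolutions with
    the gamma densities integrable on the whole line; the fractional integrals of
    f need not be integrable when the domain is unbounded. *)
Definition weighted T f : R -> R := (fun s => expR (- s) * f s) \_ (dom T).

Lemma weighted_dom T f s : dom T s -> weighted T f s = expR (- s) * f s.
Proof. by move=> Ts; rewrite /weighted patchE mem_set. Qed.

Lemma weighted_le0 T f s : s <= 0 -> weighted T f s = 0.
Proof.
by move=> s0; rewrite /weighted patchE memNset// => -[]; rewrite ltNge s0.
Qed.

Lemma integrable_weighted T f : L1 T f -> l1 (weighted T f).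
Proof.
move=> L1f.
have mw : measurable_fun (dom T) (fun s => expR (- s) * f s).
  apply: measurable_funM; last by apply/measurable_EFinP; exact: measurable_int L1f.
  apply: measurable_funTS.
  exact: (measurableT_comp (@measurable_expR R)).
apply: le_integrable (integrable_restrict_dom T f L1f) => //.
  apply/measurable_EFinP.
  by have := (measurable_restrictT _ (measurable_dom T)).1 mw.
move=> s _; rewrite /= lee_fin /weighted !patchE; case: ifPn => // sT.
rewrite normrM ler_piMl// ger0_norm ?expR_ge0// expR_le1 oppr_le0.
by case/set_mem: sT => /ltW.
Qed.

Lemma convol_le0 nu F t : (forall s, s <= 0 -> F s = 0) -> t <= 0 ->
  convol (gammad nu) F t = 0.
Proof.
move=> F0 t0; rewrite /convol /Rintegral integral0_eq// => s _.
have [s0|s0] := leP s 0; first by rewrite F0// mulr0.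
by rewrite gammad_le0 ?mul0r// subr_le0 (le_trans t0)// ltW.
Qed.

(** The composition rule for fractional integrals in weighted form. *)
Lemma ae_convol_gammadD a b F : 0 < a <= 1 -> 0 < b <= 1 -> a + b <= 1 ->
  l1 F -> \forall t \ae mu,
  convol (gammad a) (convol (gammad b) F) t = convol (gammad (a + b)) F t.
Proof.
move=> a01 b01 ab1 iF.
have := convolA _ _ _ (integrable_gammad a a01) (integrable_gammad b b01) iF.
by rewrite convol_gammad.
Qed.

Lemma l1Z c F : l1 F -> l1 (c \*o F).
Proof. by move=> /(integrableZl measurableT c); exact: eq_integrable. Qed.

Lemma l1D F G : l1 F -> l1 G -> l1 (F \+ G).
Proof. by move=> iF /(integrableD measurableT iF); exact: eq_integrable. Qed.

Lemma ae_convol_lincomb nu p q r w (F1 F2 F3 F4 : R -> R) : 0 < nu <= 1 ->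
  l1 F1 -> l1 F2 -> l1 F3 -> l1 F4 ->
  \forall t \ae mu,
  convol (gammad nu) (fun s => p * F1 s + q * F2 s + r * F3 s + w * F4 s) t =
  p * convol (gammad nu) F1 t + q * convol (gammad nu) F2 t
  + r * convol (gammad nu) F3 t + w * convol (gammad nu) F4 t.
Proof.
move=> nu01 i1 i2 i3 i4; have ig := integrable_gammad nu nu01.
have c12 := @filterI _ _ (ae_filter_ringOfSetsType mu) _ _
  (ae_convable _ _ ig i1) (ae_convable _ _ ig i2).
have c34 := @filterI _ _ (ae_filter_ringOfSetsType mu) _ _
  (ae_convable _ _ ig i3) (ae_convable _ _ ig i4).
apply: (@filterS2 _ _ (ae_filter_ringOfSetsType mu)) c12 c34.
move=> t [c1 c2] [c3 c4].
have d1 := convableZ _ _ _ p c1; have d2 := convableZ _ _ _ q c2.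
have d3 := convableZ _ _ _ r c3; have d4 := convableZ _ _ _ w c4.
rewrite -(convolZ _ _ _ p c1) -(convolZ _ _ _ q c2).
rewrite -(convolZ _ _ _ r c3) -(convolZ _ _ _ w c4).
have d12 := convableD _ _ _ _ d1 d2; have d123 := convableD _ _ _ _ d12 d3.
by rewrite -(convolD _ _ _ _ d1 d2) -(convolD _ _ _ _ d12 d3) -(convolD _ _ _ _ d123 d4).
Qed.

End domain.

(** * The semigroup equation in terms of convolutions *)

Section semigroup_equation.
Context {R : realType}.
Notation mu := (@lebesgue_measure R).
Notation l1 k := (mu.-integrable setT (EFin \o k)).
Implicit Types (nu t s a b c : R) (f h F G : R -> R) (T : \bar R).
Let aeF := ae_filter_ringOfSetsType mu.

Lemma RLint_weighted T f nu t : L1 T f -> dom T t ->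
  expR (- t) * RLint nu f t = convol (gammad nu) (weighted T f) t.
Proof.
move=> L1f Tt; apply: RLint_convol.
- by apply: l1_measurable; exact: integrable_weighted.
- exact: weighted_le0.
- move=> s /andP[s0 st]; apply: weighted_dom; apply: (dom_lt T s t Tt).
  by rewrite s0 ltW.
Qed.

(** The function H below is the weighted inner integral on the domain and is
    integrable on the line, so that its convolution can be expanded by
    linearity and by the composition rule. *)
Lemma ae_ABint_comp (B : R -> R) T f a b : L1 T f -> 0 < a -> 0 < b -> a + b <= 1 ->
  \forall t \ae mu, dom T t ->
  expR (- t) * ABint B a (ABint B b f) t =
  (1 - a) / B a * ((1 - b) / B b) * weighted T f t
  + (1 - a) / B a * (b / B b) * convol (gammad b) (weighted T f) t
  + a / B a * ((1 - b) / B b) * convol (gammad a) (weighted T f) t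
  + a / B a * (b / B b) * convol (gammad (a + b)) (weighted T f) t.
Proof.
move=> L1f a0 b0 ab1.
have a01 : 0 < a <= 1 by rewrite a0/=; lra.
have b01 : 0 < b <= 1 by rewrite b0/=; lra.
set F := weighted T f; have iF : l1 F by exact: integrable_weighted.
set u := convol (gammad b) F.
have iu : l1 u by exact: integrable_convol (integrable_gammad b b01) iF.
pose H := ((1 - b) / B b \*o F) \+ (b / B b \*o u).
have HE s : dom T s -> H s = expR (- s) * ABint B b f s.
  move=> Ts; rewrite /H /= /F /u -RLint_weighted// weighted_dom// /ABint.
  by ring.
have H0 s : s <= 0 -> H s = 0.
  move=> s0; rewrite /H /= /F weighted_le0// /u convol_le0 ?mulr0 ?addr0//.
  exact: weighted_le0.
have mH : measurable_fun setT H by apply: l1_measurable; apply: l1D; exact: l1Z.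
have ig := integrable_gammad a a01.
apply: (@filterS3 _ _ aeF) (ae_convable _ _ ig iF) (ae_convable _ _ ig iu)
  (ae_convol_gammadD a b F a01 b01 ab1 iF) => t cF cu uE Tt.
have RLH : expR (- t) * RLint a (ABint B b f) t = convol (gammad a) H t.
  apply: RLint_convol => // s /andP[s0 st].
  by rewrite HE//; apply: (dom_lt T s t Tt); rewrite s0 ltW.
rewrite [in LHS]/ABint -/(ABint B b f t).
have -> x y : expR (- t) * ((1 - a) / B a * x + a / B a * y) =
    (1 - a) / B a * (expR (- t) * x) + a / B a * (expR (- t) * y) by ring.
rewrite RLH -(HE t Tt).
rewrite /H convolD; [|exact: convableZ|exact: convableZ].
rewrite (convolZ _ _ _ _ cF) (convolZ _ _ _ _ cu) uE /=.
move: ((1 - a) / B a) (a / B a) ((1 - b) / B b) (b / B b) => a' a'' b' b''.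
move: (F t) (u t) (convol _ F t) (convol _ F t) => x y z w.
by ring.
Qed.

(** Convolution of the hypothesis with the density of order 1 - (a + b) raises
    every order by 1 - (a + b).  Convolutions at t depend on the past of t only,
    so that it is enough to know the hypothesis on the domain. *)
Lemma ae_RLint_lincomb T f a b (p q r w : R) :
  L1 T f -> 0 < a -> 0 < b -> a + b < 1 ->
  (\forall t \ae mu, dom T t ->
    p * weighted T f t + q * convol (gammad b) (weighted T f) t
    + r * convol (gammad a) (weighted T f) t
    + w * convol (gammad (a + b)) (weighted T f) t = 0) ->
  \forall t \ae mu, dom T t ->
    p * RLint (1 - (a + b)) f t + q * RLint (1 - a) f t
    + r * RLint (1 - b) f t + w * RLint 1 f t = 0.
Proof.
move=> L1f a0 b0 ab1; set F := weighted T f; set u := convol (gammad b) F.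
set v := convol (gammad a) F; set z := convol (gammad (a + b)) F => E0.
have iF : l1 F by exact: integrable_weighted.
have F0 s : s <= 0 -> F s = 0 by exact: weighted_le0.
have a01 : 0 < a <= 1 by lra.
have b01 : 0 < b <= 1 by lra.
have ab01 : 0 < a + b <= 1 by lra.
have c01 : 0 < 1 - (a + b) <= 1 by lra.
have iu : l1 u by exact: integrable_convol (integrable_gammad b b01) iF.
have iv : l1 v by exact: integrable_convol (integrable_gammad a a01) iF.
have iz : l1 z by exact: integrable_convol (integrable_gammad (a + b) ab01) iF.
pose E s := p * F s + q * u s + r * v s + w * z s.
have mE : measurable_fun setT E.
  apply: l1_measurable; rewrite /E.
  by apply: (l1D _ (w \*o z)) (l1Z _ _ iz); apply: (l1D _ (r \*o v)) (l1Z _ _ iv);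
    apply: (l1D (p \*o F) (q \*o u)); exact: l1Z.
have convolE t : dom T t -> convol (gammad (1 - (a + b))) E t = 0.
  move=> Tt; transitivity (convol (gammad (1 - (a + b))) (cst 0) t).
    apply: eq_convol_past => //; [exact: gammad_le0|exact: measurable_gammad|].
    apply: (@filterS _ _ aeF) E0 => s E0 st; have [s0|s0] := leP s 0.
      by rewrite /E F0// /u /v /z !convol_le0// !mulr0 !addr0.
    by apply: E0; apply: (dom_lt T s t Tt); rewrite s0 ltW.
  rewrite /convol; under eq_Rintegral do rewrite mulr0.
  by rewrite Rintegral_cst// mul0r.
have shift c : 0 < c <= 1 -> 1 - (a + b) + c <= 1 -> \forall t \ae mu,
    convol (gammad (1 - (a + b))) (convol (gammad c) F) t =
    convol (gammad (1 - (a + b) + c)) F t.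
  by move=> c01' ac1; exact: ae_convol_gammadD.
have uE : \forall t \ae mu,
    convol (gammad (1 - (a + b))) u t = convol (gammad (1 - a)) F t.
  by rewrite (_ : 1 - a = 1 - (a + b) + b); [apply: shift => //; lra|ring].
have vE : \forall t \ae mu,
    convol (gammad (1 - (a + b))) v t = convol (gammad (1 - b)) F t.
  by rewrite (_ : 1 - b = 1 - (a + b) + a); [apply: shift => //; lra|ring].
have zE : \forall t \ae mu,
    convol (gammad (1 - (a + b))) z t = convol (gammad 1) F t.
  have := shift (a + b) ab01.
  by rewrite (_ : 1 - (a + b) + (a + b) = 1); [apply; lra|ring].
have RLF nu t : dom T t -> expR (- t) * RLint nu f t = convol (gammad nu) F t.
  exact: RLint_weighted.
have linE := ae_convol_lincomb (1 - (a + b)) p q r w F u v z c01 iF iu iv iz.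
(* Made opaque, the convolutions are compared by name when rewriting. *)
clearbody F u v z.
have uvzE := @filterI _ _ aeF _ _ uE (@filterI _ _ aeF _ _ vE zE).
apply: (@filterS2 _ _ aeF) uvzE linE.
move=> {uE vE zE} t [uE [vE zE]] EE Tt.
have := etrans (esym EE) (convolE t Tt); rewrite {}uE {}vE {}zE {EE}.
rewrite -!(RLF _ t Tt).
move: (RLint (1 - (a + b)) f t) (RLint (1 - a) f t) => x y.
move: (RLint (1 - b) f t) (RLint 1 f t) => x' y' eq0.
have et0 : expR (- t) != 0 by rewrite gt_eqF ?expR_gt0.
apply: (mulfI et0); rewrite mulr0 -eq0.
by move: (expR (- t)) => e; ring.
Qed.

End semigroup_equation.

(** * The equation between the derivatives *)

(** At almost every t of the domain the four integrals are differentiable, and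
    the combination vanishes a.e.; hence its derivative at t is 0. *)
Lemma ae_RLder_lincomb (R : realType) (T : \bar R) (f : R -> R) (a b p q r w : R) :
  L1 T f -> RLder_defined T (a + b) f -> RLder_defined T a f ->
  RLder_defined T b f ->
  (\forall t \ae @lebesgue_measure R, dom T t ->
    p * RLint (1 - (a + b)) f t + q * RLint (1 - a) f t
    + r * RLint (1 - b) f t + w * RLint 1 f t = 0) ->
  \forall t \ae @lebesgue_measure R, dom T t ->
    p * RLder (a + b) f t + q * RLder a f t + r * RLder b f t + w * f t = 0.
Proof.
move=> L1f dab da db G0.
have aeF := ae_filter_ringOfSetsType (@lebesgue_measure R).
have d12 := @filterI _ _ aeF _ _ dab da.
have d34 := @filterI _ _ aeF _ _ db (RLint1_derive T f L1f).
apply: (@filterS2 _ _ aeF) d12 d34 => t [d1 d2] [d3 d4] Tt.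
have [{}d4 d4E] := d4 Tt.
have {}d1 : is_derive t 1 (RLint (1 - (a + b)) f) (RLder (a + b) f t).
  by rewrite /RLder derive1E; exact/derivableP/d1.
have {}d2 : is_derive t 1 (RLint (1 - a) f) (RLder a f t).
  by rewrite /RLder derive1E; exact/derivableP/d2.
have {}d3 : is_derive t 1 (RLint (1 - b) f) (RLder b f t).
  by rewrite /RLder derive1E; exact/derivableP/d3.
have {}d4 : is_derive t 1 (RLint 1 f) (f t).
  by rewrite -d4E derive1E; exact/derivableP.
have dG := is_deriveD (is_deriveD (is_deriveD (is_deriveZ p d1)
  (is_deriveZ q d2)) (is_deriveZ r d3)) (is_deriveZ w d4).
case: dG => dG <-; rewrite -derive1E.
exact: derive1_ae0 Tt (open_dom T) G0 dG.
Qed.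

Theorem mainTheorem10 (R : realType) (B : R -> R) (hB : normalisation B)
    (alpha beta : R) (halpha : 0 < alpha < 1) (hbeta : 0 < beta < 1)
    (hab : alpha + beta < 1)
    (T : \bar R) (hT : (0 < T)%E) (f : R -> R) (hf : L1 T f)
    (hDalpha : RLder_defined T alpha f)
    (hDbeta : RLder_defined T beta f)
    (hDab : RLder_defined T (alpha + beta) f) :
  let eq_general := ae_eq_on T
    (fun t =>
       ((1 - alpha) * (1 - beta) / (B alpha * B beta)
          - (1 - alpha - beta) / B (alpha + beta)) * RLder (alpha + beta) f t
       + alpha * (1 - beta) / (B alpha * B beta) * RLder beta f t
       + beta * (1 - alpha) / (B alpha * B beta) * RLder alpha f t
       + (alpha * beta / (B alpha * B beta)
          - (alpha + beta) / B (alpha + beta)) * f t)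
    (fun=> 0) in
  let eq_special := ae_eq_on T
    (fun t =>
       alpha * beta * RLder (alpha + beta) f t
       + alpha * (1 - beta) * RLder beta f t
       + beta * (1 - alpha) * RLder alpha f t
       + (alpha * beta - alpha - beta) * f t)
    (fun=> 0) in
  (ae_eq_on T (ABint B alpha (ABint B beta f)) (ABint B (alpha + beta) f) ->
     eq_general)
  /\ (B alpha * B beta = B (alpha + beta) -> (eq_general <-> eq_special)).
Proof.
have aeF := ae_filter_ringOfSetsType (@lebesgue_measure R).
case/andP: halpha => a0 a1; case/andP: hbeta => b0 b1.
case: hB => Bpos _ _.
have Ba : 0 < B alpha by apply: Bpos; lra.
have Bb : 0 < B beta by apply: Bpos; lra.
have Bab : 0 < B (alpha + beta) by apply: Bpos; lra.
move=> eq_general eq_special; split; last first.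
  move=> BE.
  (* With B alpha * B beta = B (alpha + beta), the second equation is the first
     one multiplied by this value. *)
  have E t : (alpha * beta * RLder (alpha + beta) f t
       + alpha * (1 - beta) * RLder beta f t
       + beta * (1 - alpha) * RLder alpha f t
       + (alpha * beta - alpha - beta) * f t) = B (alpha + beta) *
     (((1 - alpha) * (1 - beta) / (B alpha * B beta)
          - (1 - alpha - beta) / B (alpha + beta)) * RLder (alpha + beta) f t
       + alpha * (1 - beta) / (B alpha * B beta) * RLder beta f t
       + beta * (1 - alpha) / (B alpha * B beta) * RLder alpha f t
       + (alpha * beta / (B alpha * B beta)
          - (alpha + beta) / B (alpha + beta)) * f t).
    rewrite BE; move: Bab; generalize (RLder (alpha + beta) f t) (RLder beta f t)
      (RLder alpha f t) (B (alpha + beta)) => x y z e e0.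
    by field; rewrite gt_eqF.
  split; apply: (@filterS _ _ aeF) => t eq0 /eq0 {}eq0.
    exact: etrans (E t) (etrans (congr1 ( *%R _) eq0) (mulr0 _)).
  have /eqP := etrans (esym (E t)) eq0.
  by rewrite mulf_eq0 gt_eqF//= => /eqP.
move=> semigroup.
have comp := ae_ABint_comp B T f alpha beta hf a0 b0 (ltW hab).
set F := weighted T f in comp.
have conv_eq : \forall t \ae @lebesgue_measure R, dom T t ->
  ((1 - alpha) * (1 - beta) / (B alpha * B beta)
          - (1 - alpha - beta) / B (alpha + beta)) * F t
  + beta * (1 - alpha) / (B alpha * B beta) * convol (gammad beta) F t
  + alpha * (1 - beta) / (B alpha * B beta) * convol (gammad alpha) F t
  + (alpha * beta / (B alpha * B beta)
          - (alpha + beta) / B (alpha + beta))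
    * convol (gammad (alpha + beta)) F t = 0.
  apply: (@filterS2 _ _ aeF) semigroup comp => t sg cp Tt.
  have := cp Tt; rewrite (sg Tt) /ABint.
  have -> x y : expR (- t) * ((1 - (alpha + beta)) / B (alpha + beta) * x
      + (alpha + beta) / B (alpha + beta) * y) =
    (1 - (alpha + beta)) / B (alpha + beta) * (expR (- t) * x)
    + (alpha + beta) / B (alpha + beta) * (expR (- t) * y) by ring.
  rewrite (RLint_weighted T f _ t hf Tt) -(weighted_dom T f t Tt) -/F => /eqP.
  rewrite eq_sym -subr_eq0 => /eqP <-.
  move: Ba Bb Bab; generalize (B alpha) (B beta) (B (alpha + beta)) (F t)
    (convol (gammad alpha) F t) (convol (gammad beta) F t)
    (convol (gammad (alpha + beta)) F t) => ba bb bab x y z u ? ? ?.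
  by field; rewrite !gt_eqF.
have := ae_RLder_lincomb R T f alpha beta _ _ _ _ hf hDab hDalpha hDbeta
  (ae_RLint_lincomb T f alpha beta _ _ _ _ hf a0 b0 hab conv_eq).
apply: (@filterS _ _ aeF) => t + Tt => /(_ Tt) <-.
by generalize (RLder (alpha + beta) f t) (RLder beta f t) (RLder alpha f t); move=> *; ring.
Qed.
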